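(* Let $d\ge 1$ be an integer, let $\mathbf h\in\mathbb R^d$ with $\mathbf h\neq 0$, let $\mathrm f_\theta:\mathbb R^d\to\Delta^{|\mathcal V|}$ be a predictor, let $\delta>0$ and $\epsilon\ge 0$. Suppose the semantic coverage rate satisfies $$\alpha_\delta(\mathbf h) \;>\; 2\exp\!\Big(-\frac{(d-2)\epsilon^2}{2}\Big).$$ Then $\mathcal N^{\mathrm{dir}}_{\delta,\epsilon}(\mathbf h)\neq\varnothing$, and hence $\mathcal N_{\delta,\epsilon}(\mathbf h)\neq\varnothing$. Moreover, $$\sigma_{d-1}\big(\mathcal N^{\mathrm{dir}}_{\delta,\epsilon}(\mathbf h)\big)\;\ge\;\alpha_\delta(\mathbf h)-2\exp\!\Big(-\frac{(d-2)\epsilon^2}{2}\Big)\;>\;0.$$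
   Context: $\mathcal V$ is a finite set (vocabulary) and $\Delta^{|\mathcal V|}$ denotes the set of probability distributions on $\mathcal V$. For two such distributions $p,q$, $d_{\mathcal P}(p,q)=\sup_{S\subseteq\mathcal V}\big|\ln\frac{p(S)}{q(S)}\big|\in[0,\infty]$ is the multiplicative distance (with the convention that the term is $0$ if $p(S)=q(S)=0$ and $+\infty$ if exactly one of them is $0$). Put $r:=\|\mathbf h\|_2>0$ and $\widehat{\mathbf h}:=\mathbf h/\|\mathbf h\|_2$. Let $\mathbb S^{d-1}_1=\{\mathbf u\in\mathbb R^d:\|\mathbf u\|_2=1\}$ and let $\sigma_{d-1}$ be the uniform (rotation-invariant) Borel probability measure on $\mathbb S^{d-1}_1$. The set of semantic-preserving directions is $$\Omega_\delta(\mathbf h):=\{\mathbf u\in\mathbb S^{d-1}_1 : d_{\mathcal P}(\mathrm f_\theta(\mathbf h),\mathrm f_\theta(r\mathbf u))\le\delta\},$$ which is assumed to be Borel measurable, and the semantic coverage rate is $\alpha_\delta(\mathbf h):=\sigma_{d-1}(\Omega_\delta(\mathbf h))\in[0,1]$. The spherical $\epsilon$-orthogonal band is $$\mathcal B_\epsilon(\mathbf h):=\{\mathbf u\in\mathbb S^{d-1}_1 : |\langle\mathbf u,\widehat{\mathbf h}\rangle|\le\epsilon\}.$$ The directional obfuscated semantic null space is $\mathcal N^{\mathrm{dir}}_{\delta,\epsilon}(\mathbf h):=\Omega_\delta(\mathbf h)\cap\mathcal B_\epsilon(\mathbf h)$, and the obfuscated semantic null space is $\mathcal N_{\delta,\epsilon}(\mathbf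 h):=\{r\mathbf u : \mathbf u\in\mathcal N^{\mathrm{dir}}_{\delta,\epsilon}(\mathbf h)\}$. *)

(* Defs.v *)
From HB Require Import structures.
From mathcomp Require Import all_boot all_order all_algebra.
From mathcomp Require Import all_classical all_reals all_analysis.

Set Implicit Arguments.
Unset Strict Implicit.
Unset Printing Implicit Defensive.

Import Order.TTheory GRing.Theory Num.Theory.
Import numFieldNormedType.Exports.

Local Open Scope classical_set_scope.
Local Open Scope ring_scope.

Record simplex (R : realType) (V : finType) := Simplex {
  pmf :> {ffun V -> R};
  pmf_ge0 : forall v, 0 <= pmf v;
  pmf_sum1 : \sum_v pmf v = 1
}.

Definition mass (R : realType) (V : finType) (p : simplex R V) (S : {set V}) : R :=
  \sum_(v in S) p v.

Definition abs_log_ratio (R : realType) (a b : R) : \bar R :=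
  if (a == 0) && (b == 0) then 0%E
  else if (a == 0) || (b == 0) then +oo%E
  else `|ln (a / b)|%:E.

Definition mult_dist (R : realType) (V : finType) (p q : simplex R V) : \bar R :=
  ereal_sup (range (fun S : {set V} => abs_log_ratio (mass p S) (mass q S))).

Section Euclidean.
Variables (R : realType) (d : nat).
Implicit Types u v h : 'rV[R]_d.

Definition dotp u v : R := \sum_(i < d) u 0 i * v 0 i.

(* The library norm on row vectors is the max norm, hence this one. *)
Definition norm2 u : R := Num.sqrt (dotp u u).

Definition unit_sphere : set 'rV[R]_d := [set u | norm2 u = 1].

Definition normalize h : 'rV[R]_d := (norm2 h)^-1 *: h.

Definition borel_rV : measurableType _ := g_sigma_algebraType (@open 'rV[R]_d).

(* A Borel measure on the sphere is represented as a Borel measure on the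
   ambient space carried by the (closed) sphere. These conditions determine the
   measure uniquely. Invariance is under the full orthogonal group: when d = 1
   the only rotation of determinant 1 is the identity, and invariance under it
   would not single out the uniform measure on {-1, 1}. *)
Definition uniform_on_sphere (sigma : probability borel_rV R) : Prop :=
  sigma unit_sphere = 1%E /\
  forall Q : 'M[R]_d, Q *m Q^T = 1%:M ->
  forall A : set borel_rV, measurable A ->
    sigma [set u : 'rV[R]_d | A (u *m Q)] = sigma A.

Definition sphere_band (eps : R) h : set 'rV[R]_d :=
  [set u | unit_sphere u /\ `|dotp u (normalize h)| <= eps].

End Euclidean.

Section SemanticNullSpace.
Variables (R : realType) (d : nat) (V : finType).
Variable f : 'rV[R]_d -> simplex R V.
Implicit Types (h : 'rV[R]_d) (delta eps : R).

Definition preserving_directions delta h : set 'rV[R]_d :=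
  [set u | unit_sphere u /\
           (mult_dist (f h) (f (norm2 h *: u)) <= delta%:E)%E].

Definition coverage_rate (sigma : probability (borel_rV R d) R) delta h : \bar R :=
  sigma (preserving_directions delta h).

Definition dir_null_space delta eps h : set 'rV[R]_d :=
  preserving_directions delta h `&` sphere_band eps h.

Definition null_space delta eps h : set 'rV[R]_d :=
  [set norm2 h *: u | u in dir_null_space delta eps h].

End SemanticNullSpace.

(* Main.v *)
(* By invariance under reflections, the law of <u, v> under sigma depends only
   on |v|, so E (u_i + b u_j)^(2k+2) = (1 + b^2)^(k+1) E u_i^(2k+2) for all b.
   The coefficient of b^2, summed over j with |u| = 1, gives
   (2k + d) E u_i^(2k+2) = (2k + 1) E u_i^(2k), so that u_i is sub-Gaussian:
   E cosh (l u_i) <= exp (l^2 / (2 d)). Markov's inequality at l = d eps bounds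
   the complement of the band by 2 exp (- d eps^2 / 2), which is better than
   required. Truncating the series of cosh avoids any exchange of limit and
   integral. *)

Require Import Defs.
From mathcomp Require Import all_boot all_order all_algebra.
From mathcomp Require Import all_classical all_reals all_analysis.
From mathcomp Require Import ring lra zify.

Set Implicit Arguments.
Unset Strict Implicit.
Unset Printing Implicit Defensive.

Import Order.TTheory GRing.Theory Num.Theory.
Import numFieldNormedType.Exports.

Local Open Scope classical_set_scope.
Local Open Scope ring_scope.

(** * The Euclidean inner product and reflections *)

Section DotProduct.
Variables (R : realType) (d : nat).
Implicit Types (u v w : 'rV[R]_d) (Q : 'M[R]_d).

Lemma dotpE u v : u *m v^T = (dotp u v)%:M.
Proof.
apply/matrixP => i j; rewrite !ord1 !mxE eqxx mulr1n.
by apply: eq_bigr => k _; rewrite mxE.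
Qed.

Lemma dotpC u v : dotp u v = dotp v u.
Proof. by apply: eq_bigr => i _; rewrite mulrC. Qed.

Lemma dotpDr u v w : dotp u (v + w) = dotp u v + dotp u w.
Proof. by rewrite -big_split; apply: eq_bigr => i _; rewrite mxE mulrDr. Qed.

Lemma dotpZr a u v : dotp u (a *: v) = a * dotp u v.
Proof. by rewrite mulr_sumr; apply: eq_bigr => i _; rewrite mxE mulrCA. Qed.

Lemma dotpDl u v w : dotp (v + w) u = dotp v u + dotp w u.
Proof. by rewrite dotpC dotpDr !(dotpC u). Qed.

Lemma dotpZl a u v : dotp (a *: v) u = a * dotp v u.
Proof. by rewrite dotpC dotpZr (dotpC u). Qed.

Lemma dotp_delta u i : dotp u (delta_mx 0 i) = u 0 i.
Proof.
rewrite /dotp (bigD1 i) //= mxE !eqxx mulr1 big1 ?addr0 // => j ji.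
by rewrite mxE (negPf ji) andbF mulr0.
Qed.

Lemma dotpp_ge0 u : 0 <= dotp u u.
Proof. by apply: sumr_ge0 => i _; rewrite -expr2 sqr_ge0. Qed.

Lemma dotpp_eq0 u : (dotp u u == 0) = (u == 0).
Proof.
apply/idP/eqP => [|->]; last first.
  by rewrite /dotp big1 // => i _; rewrite mxE mul0r.
rewrite psumr_eq0 => [/allP z|i _]; last by rewrite -expr2 sqr_ge0.
apply/rowP => i; rewrite mxE; apply/eqP.
by have := z i (mem_index_enum _); rewrite /= mulf_eq0 orbb.
Qed.

Lemma unit_sphereE : @unit_sphere R d = [set u | dotp u u = 1].
Proof.
apply/seteqP; split => u; rewrite /unit_sphere /= /norm2 => h; last first.
  by rewrite h sqrtr1.
by rewrite -[LHS]sqr_sqrtr ?dotpp_ge0 // h expr1n.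
Qed.

Lemma dotp_normalize u : u != 0 -> dotp (normalize u) (normalize u) = 1.
Proof.
move=> u0; rewrite /normalize dotpZl dotpZr mulrA -expr2 exprVn /norm2.
by rewrite sqr_sqrtr ?dotpp_ge0 // mulVf // dotpp_eq0.
Qed.

Lemma dotp_mulmxr u v Q : dotp (u *m Q) v = dotp u (v *m Q^T).
Proof.
have : (u *m Q) *m v^T = u *m (v *m Q^T)^T.
  by rewrite trmx_mul trmxK mulmxA.
by rewrite !dotpE => /matrixP/(_ 0 0); rewrite !mxE eqxx !mulr1n.
Qed.

(* The Householder reflection along [v - w]. *)
Lemma orthogonal_transport v w : dotp v v = dotp w w ->
  exists2 Q : 'M[R]_d, Q *m Q^T = 1%:M & v *m Q^T = w.
Proof.
move=> vw; have [->|neq] := eqVneq v w.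
  by exists 1%:M; rewrite ?trmx1 mulmx1.
set x := v - w.
have x0 : dotp x x != 0 by rewrite dotpp_eq0 subr_eq0.
set Q : 'M[R]_d := 1%:M - (2 / dotp x x) *: (x^T *m x).
have QT : Q^T = Q by rewrite /Q linearB /= linearZ /= trmx_mul trmxK trmx1.
(* This is where equality of lengths enters. It makes the coefficient [2 * dotp v x / dotp x x]
   equal to 1, so the reflection subtracts exactly [x = v - w] from [v]. *)
have hx : dotp x x = 2 * dotp v x.
  rewrite /x !(dotpDr, dotpDl) -scaleN1r !(dotpZl, dotpZr) -vw (dotpC w v).
  by ring.
exists Q; rewrite QT /Q.
  rewrite mulmxBr mulmx1 mulmxBl mul1mx -scalemxAr -scalemxAl.
  rewrite -mulmxA (mulmxA x) dotpE mul_scalar_mx -scalemxAr !scalerA.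
  rewrite -[2 / _ * _ * _]mulrA divfK // -!addrA -opprD.
  by rewrite mulr_natr mulr2n scalerDl addrA subrr subr0.
rewrite mulmxBr mulmx1 -scalemxAr mulmxA dotpE mul_scalar_mx scalerA.
rewrite mulrAC -hx divff // scale1r /x.
by rewrite opprB addrC subrK.
Qed.

Lemma sqr_entry_le_dotpp u i : u 0 i ^+ 2 <= dotp u u.
Proof.
rewrite /dotp (bigD1 i) //= expr2 lerDl.
by apply: sumr_ge0 => j _; rewrite -expr2 sqr_ge0.
Qed.

End DotProduct.

(** * Continuity, Borel measurability and compactness in the space of row vectors *)

Section Continuity.
Variables (R : realType) (d : nat).

Lemma continuous_sum (T : topologicalType) (I : Type) (s : seq I)
    (F : I -> T -> R) : (forall i, continuous (F i)) ->
  continuous (fun x => \sum_(i <- s) F i x).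
Proof.
move=> cF; apply: (@continuous_big R I +%R 0 xpredT) => [|i _]; last exact: cF.
exact: add_continuous.
Qed.

Lemma continuousXn (T : topologicalType) (g : T -> R) n :
  continuous g -> continuous (fun x => g x ^+ n).
Proof.
move=> cg x; apply: (@continuous_comp _ _ _ g (fun y => y ^+ n)).
  exact: cg.
exact: exprn_continuous.
Qed.

Lemma continuous_mul (T : topologicalType) (f g : T -> R) :
  continuous f -> continuous g -> continuous (fun x => f x * g x).
Proof. by move=> cf cg x; apply: cvgM; [exact: cf|exact: cg]. Qed.

Lemma continuous_mull (T : topologicalType) (a : R) (g : T -> R) :
  continuous g -> continuous (fun x => a * g x).
Proof. by move=> cg x; apply: cvgM; [exact: cvg_cst|exact: cg]. Qed.

Lemma continuous_dotp (v : 'rV[R]_d) :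
  continuous (fun u : 'rV[R]_d => dotp u v).
Proof.
apply: continuous_sum => i.
apply: continuous_mul; [exact: coord_continuous|exact: cst_continuous].
Qed.

Lemma continuous_mulmxr (Q : 'M[R]_d) : continuous (fun u : 'rV[R]_d => u *m Q).
Proof.
have cQ j : continuous (fun u : 'rV[R]_d => (u *m Q) 0 j).
  under eq_fun do rewrite mxE.
  apply: continuous_sum => i.
  by apply: continuous_mul; [exact: coord_continuous|exact: cst_continuous].
(* A neighbourhood of a matrix contains a product of neighbourhoods [P] of its entries. There are
   finitely many columns, so continuity of each entry suffices. *)
move=> u A [P nP PA]; rewrite /=.
have : \forall w \near u, forall j, P 0 j ((w *m Q) 0 j).
  apply: (@filter_forall _ _ (fun j w => P 0 j ((w *m Q) 0 j)) (nbhs u)) => j.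
  exact: (cQ j u _ (nP 0 j)).
by apply: filterS => w Pw; apply: PA => i j; rewrite ord1; exact: Pw.
Qed.

Lemma continuous_measurable_rV (g : 'rV[R]_d -> R) :
  continuous g -> measurable_fun [set: borel_rV R d] (g : borel_rV R d -> R).
Proof.
move=> /continuousP cg.
apply: (measurability _ (measurable_realfun.RGenOpens.measurableE R)).
move=> _ [_ [a [b ->] <-]]; rewrite setTI.
by apply: sub_sigma_algebra; apply: cg; exact: interval_open.
Qed.

Lemma measurable_mulmxr (Q : 'M[R]_d) :
  measurable_fun [set: borel_rV R d]
    ((fun u : 'rV[R]_d => u *m Q) : borel_rV R d -> borel_rV R d).
Proof.
apply: (@measurability _ _ (borel_rV R d) (borel_rV R d) setT
  (fun u : 'rV[R]_d => u *m Q) (@open 'rV[R]_d) erefl) => _ [B oB <-].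
rewrite setTI; apply: sub_sigma_algebra.
by have /continuousP := @continuous_mulmxr Q; exact.
Qed.

Lemma closed_unit_sphere : closed (@unit_sphere R d).
Proof.
rewrite unit_sphereE; apply: (@closed_comp _ _ (fun u => dotp u u) [set 1]).
  move=> u _; move: u; apply: continuous_sum => i.
  by apply: continuous_mul; exact: coord_continuous.
exact: closed_eq.
Qed.

Lemma measurable_unit_sphere :
  measurable (@unit_sphere R d : set (borel_rV R d)).
Proof.
rewrite -[X in measurable X]setCK; apply: measurableC.
by apply: sub_sigma_algebra; exact/closed_openC/closed_unit_sphere.
Qed.

(** The sphere is closed and lies in the cube of side [[-1, 1]], which is compact as a finite
    product. Compactness later makes continuous functions bounded on the sphere, hence
    integrable. *)
Lemma compact_unit_sphere : compact (@unit_sphere R d).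
Proof.
apply: (subclosed_compact closed_unit_sphere
  (@rV_compact _ d (fun=> `[(-1 : R), 1]%classic) _)) => [_|u].
  exact: segment_compact.
rewrite unit_sphereE /= => u1 i.
rewrite in_itv /= -ler_norml -(@expr_le1 _ 2) // real_normK ?num_real //.
by rewrite -u1 sqr_entry_le_dotpp.
Qed.

End Continuity.

(** * Averages over the sphere and their orthogonal invariance *)

Section SphericalMean.
Variables (R : realType) (d : nat) (sigma : probability (borel_rV R d) R).
Hypothesis sigma_uniform : uniform_on_sphere sigma.

Let S : set (borel_rV R d) := @unit_sphere R d.
Let mS : measurable S := @measurable_unit_sphere R d.
Implicit Types (g : 'rV[R]_d -> R) (u v w : 'rV[R]_d).

(** The real-valued integral is [fine] of the extended one, so linearity requires integrability; the
    continuity hypotheses below supply it. *)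
Definition sphere_mean g : R := \int[sigma]_(u in S) g u.

Lemma integrable_sphere g : continuous g -> sigma.-integrable S (EFin \o g).
Proof.
move=> cg; apply: measurable_bounded_integrable => //.
- by rewrite (le_lt_trans (probability_le1 _ mS)) // ltry.
- by apply: measurable_funTS; exact: continuous_measurable_rV.
- have cS := continuous_compact (continuous_subspaceT cg)
    (@compact_unit_sphere R d).
  have [M [Mr HM]] := compact_bounded cS.
  by exists M; split => // x Mx u Su; apply: HM => //; exists u.
Qed.

Lemma sphere_meanZ a g : continuous g ->
  sphere_mean (fun u => a * g u) = a * sphere_mean g.
Proof.
by move=> cg; rewrite /sphere_mean RintegralZl //; exact: integrable_sphere.
Qed.

Lemma sphere_mean_sum (I : Type) (s : seq I) (G : I -> 'rV[R]_d -> R) :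
  (forall i, continuous (G i)) ->
  sphere_mean (fun u => \sum_(i <- s) G i u) = \sum_(i <- s) sphere_mean (G i).
Proof.
move=> cG; elim: s => [|i s ih].
  rewrite big_nil /sphere_mean; under eq_Rintegral do rewrite big_nil.
  by rewrite Rintegral_cst // mul0r.
rewrite big_cons -ih /sphere_mean; under eq_Rintegral do rewrite big_cons.
by rewrite RintegralD //; apply: integrable_sphere => //; exact: continuous_sum.
Qed.

Lemma eq_sphere_mean g1 g2 : (forall u, dotp u u = 1 -> g1 u = g2 u) ->
  sphere_mean g1 = sphere_mean g2.
Proof.
move=> g12; apply: eq_Rintegral => u; rewrite inE /S unit_sphereE; exact: g12.
Qed.

Lemma sphere_mean_ge0 g : (forall u, 0 <= g u) -> 0 <= sphere_mean g.
Proof. by move=> g0; apply: Rintegral_ge0. Qed.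

Lemma sphere_mean1 : sphere_mean (fun=> 1) = 1.
Proof.
rewrite /sphere_mean Rintegral_cst // mul1r.
by rewrite (_ : _ S = 1%E) //; exact: sigma_uniform.1.
Qed.

(** Change of variables along [phi]: the sphere is its own preimage, and invariance says that the
    pushforward of [sigma] is [sigma] itself. *)
Lemma sphere_mean_orthogonal Q g : Q *m Q^T = 1%:M -> continuous g ->
  sphere_mean (fun u => g (u *m Q)) = sphere_mean g.
Proof.
move=> oQ cg.
pose phi : borel_rV R d -> borel_rV R d := fun u : 'rV[R]_d => u *m Q.
have mphi : measurable_fun setT phi := @measurable_mulmxr R d Q.
have phiS : phi @^-1` S = S.
  apply/seteqP; split => u; rewrite /S unit_sphereE /preimage /=;
    by rewrite /phi dotp_mulmxr -mulmxA oQ mulmx1.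
rewrite /sphere_mean /Rintegral; congr fine.
have := @integral_pushforward _ _ _ _ _ phi mphi sigma S (EFin \o g).
rewrite phiS => <- //.
- apply: eq_measure_integral => A mA _.
  by rewrite /pushforward; exact: sigma_uniform.2.
- by apply/measurable_realfun.measurable_EFinP; exact: continuous_measurable_rV.
- apply: integrable_sphere => u.
  exact: (@continuous_comp _ _ _ (fun u : 'rV[R]_d => u *m Q) g u
    (@continuous_mulmxr R d Q u) (cg _)).
Qed.

(** An orthogonal [Q] with [w *m Q^T = v] turns [dotp (u *m Q) w] into [dotp u v]. All later uses of
    invariance go through this lemma. *)
Lemma sphere_mean_dotp (F : R -> R) v w : continuous F -> dotp v v = dotp w w ->
  sphere_mean (fun u => F (dotp u v)) = sphere_mean (fun u => F (dotp u w)).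
Proof.
move=> cF vw; have [Q oQ vQ] := orthogonal_transport (esym vw).
rewrite -(@sphere_mean_orthogonal Q (fun u => F (dotp u w))) //; last first.
  move=> u.
  exact: (@continuous_comp _ _ _ (fun u : 'rV[R]_d => dotp u w) F u
    (@continuous_dotp _ _ w u) (cF _)).
by apply: eq_sphere_mean => u _; rewrite dotp_mulmxr vQ.
Qed.

End SphericalMean.

(** * Polynomial identities for comparing coefficients *)

(** If [p - q] were nonzero, the first [size (p - q)] natural numbers would be distinct roots of it,
    one more than its degree allows. *)
Lemma horner_inj (R : numDomainType) (p q : {poly R}) :
  (forall x, p.[x] = q.[x]) -> p = q.
Proof.
move=> pq; apply/eqP; rewrite -subr_eq0; apply/contraT => pq0.
have := max_poly_roots (rs := [seq i%:R | i <- iota 0 (size (p - q))]) pq0.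
rewrite size_map size_iota ltnn; apply.
  by apply/allP => x _; rewrite rootE hornerD hornerN pq subrr.
by rewrite map_inj_uniq ?iota_uniq // => m n /eqP; rewrite eqr_nat => /eqP.
Qed.

Lemma coef0_1DXn2_exp (R : nzRingType) k : ((1 + 'X^2 : {poly R}) ^+ k)`_0 = 1.
Proof.
elim: k => [|k ih]; first by rewrite expr0 coef1.
by rewrite exprS mulrDl mul1r coefD ih coefXnM addr0.
Qed.

Lemma coef2_1DXn2_exp (R : nzRingType) k :
  ((1 + 'X^2 : {poly R}) ^+ k)`_2 = k%:R.
Proof.
elim: k => [|k ih]; first by rewrite expr0 coef1.
by rewrite exprS mulrDl mul1r coefD ih coefXnM coef0_1DXn2_exp natr1.
Qed.

(** * Even moments of one coordinate *)

Section Moments.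
Variables (R : realType) (d : nat) (sigma : probability (borel_rV R d) R).
Hypothesis sigma_uniform : uniform_on_sphere sigma.
Variable i : 'I_d.

Definition moment k := sphere_mean sigma (fun u => u 0 i ^+ (2 * k)).

Lemma moment_ge0 k : 0 <= moment k.
Proof. by apply: sphere_mean_ge0 => u; rewrite exprM exprn_ge0 // sqr_ge0. Qed.

Lemma moment0 : moment 0 = 1.
Proof.
by rewrite /moment; under eq_fun do rewrite muln0 expr0; exact: sphere_mean1.
Qed.

(** The vectors [v], with entries 1 at [i] and [b] at [j], and [w], with the single entry
    [Num.sqrt (1 + b ^+ 2)] at [i], have the same length, so [sphere_mean_dotp] applies to the power
    function. *)
Lemma moment_rotation j k (b : R) : j != i ->
  sphere_mean sigma (fun u => (u 0 i + b * u 0 j) ^+ (2 * k)) =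
  (1 + b ^+ 2) ^+ k * moment k.
Proof.
move=> ji; have b0 : 0 <= 1 + b ^+ 2 by rewrite addr_ge0 ?ler01 ?sqr_ge0.
pose v : 'rV[R]_d := delta_mx 0 i + b *: delta_mx 0 j.
pose w : 'rV[R]_d := Num.sqrt (1 + b ^+ 2) *: delta_mx 0 i.
have vE u : dotp u v = u 0 i + b * u 0 j by rewrite dotpDr dotpZr !dotp_delta.
have wE u : dotp u w = Num.sqrt (1 + b ^+ 2) * u 0 i.
  by rewrite dotpZr dotp_delta.
have vw : dotp v v = dotp w w.
  rewrite vE wE !mxE !eqxx (negPf ji) eq_sym (negPf ji) /=.
  by rewrite [RHS]mulrA -expr2 sqr_sqrtr //; ring.
have := sphere_mean_dotp sigma_uniform (@exprn_continuous R (2 * k)) vw.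
under eq_fun do rewrite vE; move=> ->.
under eq_fun do rewrite wE exprMn [X in X * _]exprM sqr_sqrtr //.
by rewrite sphere_meanZ //; apply: continuousXn; exact: coord_continuous.
Qed.

(** Both sides of [moment_rotation] at [k.+1] are polynomials in [b]. Their coefficients of [b ^+ 2]
    are ['C(n, 2)] times the mixed moment and [k.+1] times [moment k.+1]. *)
Lemma mixed_moment j k : j != i ->
  (2 * k + 1)%:R * sphere_mean sigma (fun u => u 0 i ^+ (2 * k) * u 0 j ^+ 2) =
  moment k.+1.
Proof.
move=> ji; set n := (2 * k.+1)%N.
pose m l := sphere_mean sigma (fun u => u 0 i ^+ (n - l) * u 0 j ^+ l).
pose p : {poly R} := \poly_(l < n.+1) ('C(n, l)%:R * m l).
have cm l : continuous (fun u : 'rV[R]_d => u 0 i ^+ (n - l) * u 0 j ^+ l).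
  by apply: continuous_mul; apply: continuousXn; exact: coord_continuous.
have : p = moment k.+1 *: (1 + 'X^2) ^+ k.+1.
  apply: horner_inj => b; rewrite horner_poly hornerZ horner_exp.
  rewrite hornerD hornerXn hornerC mulrC -(moment_rotation _ _ ji).
  transitivity (sphere_mean sigma (fun u => \sum_(l < n.+1)
      ('C(n, l)%:R * b ^+ l) * (u 0 i ^+ (n - l) * u 0 j ^+ l))).
    rewrite sphere_mean_sum; last by move=> l; exact: continuous_mull.
    by apply: eq_bigr => l _; rewrite sphere_meanZ // mulrAC.
  apply: eq_sphere_mean => u _; rewrite exprDn.
  by apply: eq_bigr => l _; rewrite exprMn -[RHS]mulr_natl; ring.
move=> /(congr1 (fun q : {poly R} => q`_2)).
(* With [n = 2 * k + 2], the binomial contains the factor [k.+1] of the other side, which then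
   cancels. *)
have binE : 'C(n, 2) = ((2 * k + 1) * k.+1)%N.
  by rewrite bin2 -[RHS]doubleK /n; congr _./2; lia.
rewrite coefZ coef2_1DXn2_exp coef_poly binE ifT; last by rewrite /n; lia.
rewrite natrM mulrAC => /mulIf <-; last by rewrite pnatr_eq0.
by rewrite /m (_ : n - 2 = 2 * k)%N // /n; lia.
Qed.

(** Multiply [u 0 i ^+ (2 * k)] by the sum of all squared entries, which is 1 on the sphere. The
    term [j = i] is [moment k.+1]; each of the [d - 1] others contributes
    [moment k.+1 / (2 * k + 1)]. *)
Lemma moment_rec k :
  (2 * k + d)%:R * moment k.+1 = (2 * k + 1)%:R * moment k.
Proof.
have cm j : continuous (fun u : 'rV[R]_d => u 0 i ^+ (2 * k) * u 0 j ^+ 2).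
  by apply: continuous_mul; apply: continuousXn; exact: coord_continuous.
have -> : moment k =
    \sum_j sphere_mean sigma (fun u => u 0 i ^+ (2 * k) * u 0 j ^+ 2).
  rewrite -sphere_mean_sum //; apply: eq_sphere_mean => u u1.
  rewrite -mulr_sumr (_ : \sum_j u 0 j ^+ 2 = 1) ?mulr1 //.
rewrite (bigD1 i) //= mulrDr mulr_sumr (eq_bigr _ (fun j => @mixed_moment j k)).
rewrite sumr_const cardC1 card_ord.
rewrite (_ : sphere_mean _ _ = moment k.+1); last first.
  by apply: eq_sphere_mean => u _; rewrite -exprD mulnS addnC.
rewrite -[moment k.+1 *+ _]mulr_natl -mulrDl -natrD; congr (_%:R * _).
(* The index [i] shows that [d] is positive, so the truncated [d.-1] really is [d - 1]. *)
by have := ltn_ord i; lia.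
Qed.

(** Induction on ratios of consecutive terms. By [moment_rec] the ratio on the left is at most
    [(2k+1)/d * x^2/((2k+1)(2k+2))], which equals [x^2/(2d(k+1))], the ratio on the right. *)
Lemma moment_le k x : moment k * (x ^+ (2 * k) / (2 * k)`!%:R) <=
  exp_coeff (x ^+ 2 / (2 * d%:R)) k.
Proof.
have d0 : 0 < d%:R :> R by rewrite ltr0n (leq_ltn_trans _ (ltn_ord i)).
rewrite /exp_coeff /=; elim: k => [|k ih].
  by rewrite moment0 !expr0 !fact0 divr1 mulr1.
(* The factor [2 * k + d] of the recursion is bounded below by [d]. *)
have Mle : moment k.+1 <= (2 * k + 1)%:R / d%:R * moment k.
  rewrite mulrAC ler_pdivlMr // -moment_rec mulrC ler_wpM2r ?moment_ge0 //.
  by rewrite ler_nat leq_addl.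
set q := x ^+ 2 / (2 * d%:R).
have q0 : 0 <= q by rewrite divr_ge0 ?sqr_ge0 // mulr_ge0 // ltW.
have f0 n : n`!%:R != 0 :> R by rewrite pnatr_eq0 -lt0n fact_gt0.
have a0 : 0 <= k%:R :> R by rewrite ler0n.
(* The new factor is written so that [d%:R / (2 * k + 1)%:R] cancels against the constant in [Mle],
   leaving the ratio [q / k.+1%:R]. *)
have -> : x ^+ (2 * k.+1) / (2 * k.+1)`!%:R =
    x ^+ (2 * k) / (2 * k)`!%:R * (d%:R / (2 * k + 1)%:R * (q / k.+1%:R)).
  rewrite (_ : 2 * k.+1 = (2 * k).+2)%N; last by lia.
  rewrite !factS !natrM -!natr1 natrD natrM /q.
  rewrite !exprS; field.
  rewrite f0 /=; do ?[apply/andP; split]; lra.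
rewrite exprSr factS natrM.
rewrite (_ : q ^+ k * q / _ = q ^+ k / k`!%:R * (q / k.+1%:R)); last first.
  by rewrite -!natr1; field; rewrite f0 /=; lra.
apply: le_trans (ler_wpM2r _ ih); last by rewrite divr_ge0.
have t0 : 0 <= x ^+ (2 * k) / (2 * k)`!%:R *
    (d%:R / (2 * k + 1)%:R * (q / k.+1%:R)).
  have x0 : 0 <= x ^+ (2 * k) by rewrite exprM exprn_ge0 // sqr_ge0.
  by rewrite mulr_ge0 ?divr_ge0 // mulr_ge0 // divr_ge0.
apply: le_trans (ler_wpM2r t0 Mle) _; rewrite le_eqVlt; apply/orP; left.
apply/eqP; rewrite natrD natrM -!natr1; field.
rewrite f0 /=; do ?[apply/andP; split]; lra.
Qed.

End Moments.

(** * Truncations of the hyperbolic cosine series *)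

Section CoshPartial.
Variable R : realType.
Implicit Types x : R.

(** The Taylor polynomial of cosh with [n] terms. Being a finite sum of even powers, its spherical
    mean is a finite combination of moments. *)
Definition cosh_partial n x : R := \sum_(k < n) x ^+ (2 * k) / (2 * k)`!%:R.

Lemma exp_coeff_add_oppr x n :
  exp_coeff x n + exp_coeff (- x) n =
  if odd n then 0 else 2 * (x ^+ n / n`!%:R).
Proof.
rewrite /exp_coeff /= -mulrDl exprNn -signr_odd.
by case: odd; rewrite ?expr1 ?expr0; ring.
Qed.






(** Odd degrees cancel and even ones double; [uphalf n] counts the even degrees below [n]. *)
Lemma series_exp_coeff_add_oppr x n :
  series (exp_coeff x) n + series (exp_coeff (- x)) n =
  2 * cosh_partial (uphalf n) x.
Proof.
elim: n => [|n ih].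
  by rewrite /series /= !big_geq // /cosh_partial big_ord0 mulr0 addr0.
rewrite !seriesSr addrACA ih exp_coeff_add_oppr /= uphalf_half.
case: ifPn => [on|en]; first by rewrite addr0.
rewrite add0n /cosh_partial big_ord_recr /= mulrDr; congr (_ + 2 * _).
by rewrite mul2n halfK (negPf en) subn0.
Qed.

(** A bound on all truncations passes to the limit, which is half of [expR x + expR (- x)]. Dropping
    [expR (- x)] leaves the factor 2 that appears in the tail bound. *)
Lemma expR_le_cosh_partial x C :
  (forall n, cosh_partial n x <= C) -> expR x <= 2 * C.
Proof.
move=> TC; apply: (@le_trans _ _ (expR x + expR (- x))).
  by rewrite lerDl expR_ge0.
have c : (series (exp_coeff x) n + series (exp_coeff (- x)) n) @[n --> \oo] -->
    expR x + expR (- x) by apply: cvgD; exact: is_cvg_series_exp_coeff.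
apply: (ler_cvg_to c (cvg_cst (2 * C))); apply: nearW => n.
by rewrite series_exp_coeff_add_oppr ler_pM2l.
Qed.

(** Only even powers occur, so both caps outside the band can be treated at once. *)
Lemma le_cosh_partial n x y :
  `|x| <= `|y| -> cosh_partial n x <= cosh_partial n y.
Proof.
move=> xy; apply: ler_sum => k _.
rewrite ler_pM2r ?invr_gt0 ?ltr0n ?fact_gt0 //.
rewrite !exprM -(real_normK (num_real x)) -(real_normK (num_real y)).
by rewrite !lerXn2r ?nnegrE ?exprn_ge0.
Qed.

Lemma continuous_cosh_partial n : continuous (cosh_partial n).
Proof.
apply: continuous_sum => k x.
by apply: cvgM; [exact: exprn_continuous|exact: cvg_cst].
Qed.

Lemma cosh_partial_ge0 n x : 0 <= cosh_partial n x.
Proof.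
by apply: sumr_ge0 => k _; rewrite divr_ge0 // exprM exprn_ge0 // sqr_ge0.
Qed.

Lemma series_exp_coeff_le_expR x n : 0 <= x -> series (exp_coeff x) n <= expR x.
Proof.
move=> x0; apply: nondecreasing_cvgn_le; last exact: is_cvg_series_exp_coeff.
by apply: nondecreasing_series => k _ _; exact: exp_coeff_ge0.
Qed.

End CoshPartial.

(** * Exponential moments and the measure outside the band *)

Section Tail.
Variables (R : realType) (d : nat) (sigma : probability (borel_rV R d) R).
Hypothesis sigma_uniform : uniform_on_sphere sigma.
Implicit Types v : 'rV[R]_d.

(** Invariance replaces [v] by the basis vector at [i]. Then [moment_le], applied term by term,
    bounds the mean by a partial sum of the exponential series. *)
Lemma sphere_mean_cosh_le (i : 'I_d) v n (l : R) : dotp v v = 1 ->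
  sphere_mean sigma (fun u => cosh_partial n (l * dotp u v)) <=
  expR (l ^+ 2 / (2 * d%:R)).
Proof.
move=> v1; pose F y := cosh_partial n (l * y).
have cF : continuous F.
  move=> y; apply: (@continuous_comp _ _ _ ( *%R l) (cosh_partial n)).
    by apply: cvgM; [exact: cvg_cst|exact: cvg_id].
  exact: continuous_cosh_partial.
have e1 : dotp (delta_mx 0 i : 'rV[R]_d) (delta_mx 0 i) = 1.
  by rewrite dotp_delta mxE !eqxx.
rewrite (sphere_mean_dotp sigma_uniform cF (etrans v1 (esym e1))).
rewrite (@eq_sphere_mean _ _ _ _ (fun u => \sum_(k < n)
    l ^+ (2 * k) / (2 * k)`!%:R * u 0 i ^+ (2 * k))); last first.
  move=> u _; rewrite dotp_delta; apply: eq_bigr => k _.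
  by rewrite exprMn mulrAC.
have ci k : continuous (fun u : 'rV[R]_d => u 0 i ^+ (2 * k)).
  by apply: continuousXn; exact: coord_continuous.
rewrite sphere_mean_sum; last by move=> k; exact: continuous_mull.
apply: (@le_trans _ _ (series (exp_coeff (l ^+ 2 / (2 * d%:R))) n)).
  rewrite /series /= big_mkord; apply: ler_sum => k _.
  by rewrite sphere_meanZ // mulrC; exact: moment_le.
by apply: series_exp_coeff_le_expR; rewrite divr_ge0 ?sqr_ge0.
Qed.

Lemma measurable_sphere_band (eps : R) v :
  measurable (sphere_band eps v : set (borel_rV R d)).
Proof.
apply: measurableI; first exact: measurable_unit_sphere.
have mf := continuous_measurable_rV (@continuous_dotp R d (normalize v)).
have := measurableT_comp (@measurable_realfun.normr_measurable R setT) mf.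
move=> /(_ measurableT `]-oo, eps]%classic (measurable_itv _)).
by rewrite setTI; congr measurable; apply/seteqP; split => u /=; rewrite in_itv.
Qed.

Lemma sphere_tail_le (eps : R) v : (0 < d)%N -> v != 0 -> 0 <= eps ->
  (sigma (@unit_sphere R d `\` sphere_band eps v) <=
   (2 * expR (- (d%:R * eps ^+ 2 / 2)))%:E)%E.
Proof.
(* This [l] minimises the exponent [l ^+ 2 / (2 * d%:R) - l * eps] obtained below. *)
move=> d0 v0 eps0; set v' := normalize v; set l : R := d%:R * eps.
have v'1 : dotp v' v' = 1 by exact: dotp_normalize.
set S : set (borel_rV R d) := @unit_sphere R d.
have mS : measurable S := @measurable_unit_sphere R d.
set A : set (borel_rV R d) := _ `\` _.
have mA : measurable A.
  by apply: measurableD => //; exact: measurable_sphere_band.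
have Afin : sigma A \is a fin_num by exact: fin_num_measure.
rewrite -(fineK Afin) lee_fin; set p := fine _.
have p0 : 0 <= p by exact: fine_ge0.
(* Markov's inequality for each truncation: on [A] the integrand is at least
   [cosh_partial n (l * eps)], and it is nonnegative on the rest of the sphere. *)
have le_mean n : p * cosh_partial n (l * eps) <= expR (l ^+ 2 / (2 * d%:R)).
  apply: le_trans (sphere_mean_cosh_le (Ordinal d0) n l v'1).
  have cF : continuous (fun u : 'rV[R]_d => cosh_partial n (l * dotp u v')).
    move=> u; apply: (@continuous_comp _ _ _ (fun u => l * dotp u v')
      (cosh_partial n)); last exact: continuous_cosh_partial.
    by apply: continuous_mull; exact: continuous_dotp.
  have iF := integrable_sphere sigma cF.
  rewrite -lee_fin /sphere_mean /Rintegral fineK; last first.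
    exact: integrable_fin_num.
  rewrite EFinM fineK // muleC -integral_cst //.
  apply: (@le_trans _ _
    (\int[sigma]_(u in A) (cosh_partial n (l * dotp u v'))%:E)%E).
    apply: ge0_le_integral => //.
    - by move=> u _; rewrite /= lee_fin cosh_partial_ge0.
    - apply/measurable_realfun.measurable_EFinP; apply: measurable_funTS.
      exact: continuous_measurable_rV.
    - move=> u [Su Bu]; rewrite lee_fin le_cosh_partial // !normrM.
      rewrite ler_wpM2l // (ger0_norm eps0) leNgt; apply/negP => /ltW le_eps.
      exact: Bu.
  apply: ge0_subset_integral => //.
  - apply/measurable_realfun.measurable_EFinP; apply: measurable_funTS.
    exact: continuous_measurable_rV.
  - by move=> u _; rewrite lee_fin cosh_partial_ge0.
  - by move=> u [].
(* The case [p = 0] is set apart because the bound on the truncations is obtained by dividing by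
   [p]. *)
have [->|pN0] := eqVneq p 0; first by rewrite mulr_ge0 ?expR_ge0.
have {pN0 p0} p_gt0 : 0 < p by rewrite lt_def pN0.
have : expR (l * eps) <= 2 * (expR (l ^+ 2 / (2 * d%:R)) / p).
  by apply: expR_le_cosh_partial => n; rewrite ler_pdivlMr // mulrC.
rewrite mulrA ler_pdivlMr // => le_p.
have -> : - (d%:R * eps ^+ 2 / 2) = l ^+ 2 / (2 * d%:R) - l * eps.
  by rewrite /l; field; rewrite pnatr_eq0 -lt0n.
by rewrite expRD expRN mulrA ler_pdivlMr ?expR_gt0 // mulrC.
Qed.

End Tail.

(** * Comparison of the coverage rate with the tail bound *)

Theorem theorem2p5 (R : realType) (d : nat) (V : finType)
    (sigma : probability (borel_rV R d) R)
    (h : 'rV[R]_d) (f : 'rV[R]_d -> simplex R V) (delta eps : R)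
    (d_ge1 : (1 <= d)%N)
    (sigma_uniform : uniform_on_sphere sigma)
    (h_neq0 : h != 0)
    (delta_gt0 : 0 < delta)
    (eps_ge0 : 0 <= eps)
    (Omega_measurable :
       measurable (preserving_directions f delta h : set (borel_rV R d)))
    (coverage_gt :
       ((2 * expR (- ((d%:R - 2) * eps ^+ 2 / 2)))%:E
          < coverage_rate f sigma delta h)%E) :
  [/\ dir_null_space f delta eps h !=set0,
      null_space f delta eps h !=set0,
      (coverage_rate f sigma delta h
         - (2 * expR (- ((d%:R - 2) * eps ^+ 2 / 2)))%:E
       <= sigma (dir_null_space f delta eps h))%E &
      (0 < coverage_rate f sigma delta h
             - (2 * expR (- ((d%:R - 2) * eps ^+ 2 / 2)))%:E)%E].
Proof.
set t : R := 2 * expR _ in coverage_gt *.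
set O : set (borel_rV R d) := preserving_directions f delta h
  in Omega_measurable.
set N := dir_null_space f delta eps h.
have mB : measurable (sphere_band eps h : set (borel_rV R d)).
  exact: measurable_sphere_band.
have mN : measurable (N : set (borel_rV R d)) by exact: measurableI.
pose A : set (borel_rV R d) := @unit_sphere R d `\` sphere_band eps h.
have mA : measurable A.
  by apply: measurableD => //; exact: measurable_unit_sphere.
(* The tail bound has [d] in the exponent, and [d - 2 <= d] gives the weaker constant [t]. The
   difference is taken in the reals, so it may be negative. *)
have At : (sigma A <= t%:E)%E.
  apply: le_trans (sphere_tail_le sigma_uniform d_ge1 h_neq0 eps_ge0) _.
  rewrite lee_fin ler_pM2l // ler_expR lerN2 ler_pM2r ?invr_gt0 //.
  by rewrite ler_wpM2r ?sqr_ge0 // gerBl.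
(* Every preserving direction is a unit vector, so it lies in [N] or in [A]; subadditivity then
   gives the bound. *)
have lower : (coverage_rate f sigma delta h - t%:E <= sigma N)%E.
  rewrite leeBlDr //; apply: le_trans (leeD2l (sigma N) At).
  apply: le_trans (measureU2 _ mN mA).
  apply: le_measure; rewrite ?inE //; first exact: measurableU.
  move=> u Ou; have [Bu|Bu] := pselect (sphere_band eps h u); first by left.
  by right; split => //; case: Ou.
have gap : (0 < coverage_rate f sigma delta h - t%:E)%E by rewrite sube_gt0.
(* An empty [N] would have measure 0, against the positive lower bound. *)
have [u Nu] : N !=set0.
  apply/set0P; apply: contraTneq (lt_le_trans gap lower) => ->.
  by rewrite measure0 ltxx.
by split => //; [exists u | exists (norm2 h *: u), u].
Qed.
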